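(* A permutation $\pi\in S_n$ has a direct tangle (a tangle solving $\pi$ in which every path has at most $2$ corners) if and only if $\pi$ is $321$-avoiding.
   Context: $S_n$ is the set of permutations $\pi=[\pi(1),\dots,\pi(n)]$ of $\{1,\dots,n\}$, where $\pi(p)$ is the element at position $p$. For $1\le i<n$, the swap $\sigma(i)$ transforms $\pi$ into $\pi\cdot\sigma(i)$ by exchanging the elements in positions $i$ and $i+1$. Two permutations are adjacent if one is obtained from the other by applying swaps $\sigma(p_1),\dots,\sigma(p_k)$ ($k\ge 0$) with $|p_i-p_j|\ge 2$ for $i\ne j$. A tangle is a finite sequence $\pi_0,\dots,\pi_m$ of permutations in $S_n$ in which consecutive permutations are adjacent; it solves $\pi$ if $\pi_0=\pi$ and $\pi_m$ is the identity; by convention the first and last permutations are repeated ($\pi_0=\pi_1$, $\pi_{m-1}=\pi_m$). In the drawing of the tangle, element $x$ at time $t$ is placed at the point $(p,-t)$ where $\pi_t(p)=x$, and path $x$ is the polyline joining these points for $t=0,\dots,m$; its pieces are vertical or at $\pm45^\circ$ to the vertical. A corner of a path is a point where it changes direction, counted with multiplicity (a change between the two diagonal directions counts as $2$). A permutation $\pi\in S_n$ contains a pattern $\mu\in S_k$ if there are positions $i_1<\dots<i_k$ such that for all $r<s$, $\pi(i_r)<\pi(i_s)$ iff $\mu(r)<\mu(s)$; otherwise it avoids $\mu$. $321$-avoiding means avoiding $\mu=[3,2,1]$. *)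

(* Defs.v *)
From mathcomp Require Import all_boot all_order all_algebra all_fingroup.

Set Implicit Arguments.
Unset Strict Implicit.
Unset Printing Implicit Defensive.

Import Order.TTheory GRing.Theory Num.Theory.
Local Open Scope ring_scope.

(* Positions, elements and pattern indices are numbered from 0: an element    *)
(* pi of 'S_n maps the position p : 'I_n to the element pi p placed there.    *)

Section Tangles.

Variable n : nat.
Implicit Types (pi rho : 'S_n) (T : seq 'S_n) (p x : 'I_n) (t : nat).

Lemma ltn_pos_succ (i : 'I_n.-1) : (i.+1 < n)%N.
Proof. by rewrite -ltn_predRL. Qed.

Definition sigma (i : 'I_n.-1) : 'S_n :=
  tperm (Ordinal (ltnW (ltn_pos_succ i))) (Ordinal (ltn_pos_succ i)).

(* permM reads (s * t) p = t (s p), so the product that acts on positions     *)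
(* has sigma i as its left factor.                                            *)
Definition swap pi (i : 'I_n.-1) : 'S_n := (sigma i * pi)%g.

Definition far_apart (i j : 'I_n.-1) : bool := 2 <= `|i%:Z - j%:Z|.

Definition obtained_from pi rho : Prop :=
  exists2 ps : seq 'I_n.-1, pairwise far_apart ps & rho = foldl swap pi ps.

Definition adjacent pi rho : Prop :=
  obtained_from pi rho \/ obtained_from rho pi.

(* The permutation pi_t; the default value 1 is only reached for t > m, where *)
(* m = (size T).-1.                                                           *)
Definition perm_at T t : 'S_n := nth 1%g T t.

(* Repeating the first and last permutations requires m >= 1; for m = 1 the   *)
(* two repetitions coincide.                                                  *)
Definition is_tangle T : Prop :=
  let m := (size T).-1 in
  [/\ (1 < size T)%N,
      forall t, (t < m)%N -> adjacent (perm_at T t) (perm_at T t.+1),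
      perm_at T 0 = perm_at T 1
    & perm_at T m.-1 = perm_at T m].

Definition solves T pi : Prop :=
  perm_at T 0 = pi /\ perm_at T (size T).-1 = 1%g.

(* The vertex at time t of path x, in the plane: the position of x is         *)
(* (perm_at T t)^-1 x, shifted by one to number the columns from 1.           *)
Definition path_point T x t : int * int :=
  (((perm_at T t)^-1%g x).+1%:Z, - t%:Z).

Definition path_piece T x t : int * int :=
  path_point T x t.+1 - path_point T x t.

(* All pieces descend by exactly 1, so two of them have the same direction    *)
(* iff they are equal as vectors, and a piece is diagonal iff its first       *)
(* coordinate is nonzero.                                                     *)
Definition corner_mult (u v : int * int) : nat :=
  if u == v then 0%N
  else if (u.1 != 0) && (v.1 != 0) then 2%N else 1%N.

(* A corner can only occur at an intermediate time 0 < t < m.                 *)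
Definition corners T x : nat :=
  (\sum_(1 <= t < (size T).-1)
     corner_mult (path_piece T x t.-1) (path_piece T x t))%N.

Definition direct_tangle T pi : Prop :=
  [/\ is_tangle T, solves T pi & forall x, (corners T x <= 2)%N].

Definition contains pi k (mu : 'S_k) : Prop :=
  exists2 i : 'I_k -> 'I_n,
    forall r s : 'I_k, (r < s)%N -> (i r < i s)%N
  & forall r s : 'I_k, (r < s)%N -> (pi (i r) < pi (i s))%N = (mu r < mu s)%N.

Definition avoids pi k (mu : 'S_k) : Prop := ~ contains pi mu.

End Tangles.

(* The permutation [3, 2, 1], that is, r |-> 2 - r on 'I_3.                   *)
Definition perm321 : 'S_3 := perm (@rev_ord_inj 3).

(* Main.v *)
(* With at most two corners, and vertical at both ends, a path never moves     *)
(* both left and right; but the middle element of a 321 pattern moves right    *)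
(* when it crosses the smallest element and left when it crosses the largest.  *)
(*   Conversely, if pi avoids 321, the elements starting left of their target, *)
(* called right movers, appear in increasing order, and so do the other ones,  *)
(* called left movers. At the crossing of the i-th right mover with the j-th   *)
(* left mover the two occupy the positions i + j and i + j + 1, whatever the   *)
(* tangle; so this crossing can be scheduled at time j - i. Each path then     *)
(* crosses the others at consecutive times.                                    *)

Require Import Defs.
From mathcomp Require Import all_boot all_order all_algebra all_fingroup.
From mathcomp Require Import zify.

Set Implicit Arguments.
Unset Strict Implicit.
Unset Printing Implicit Defensive.

Import GRing.Theory.

(** By [adjacent_close], permutations are adjacent iff no element moves by more than one position,
    so velocities lie in {-1, 0, 1} and [corners_velocity] makes the corners of a path the total
    variation of its velocity. Starting and ending at velocity 0, a path of variation at most 2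
    cannot have both velocities 1 and -1 ([sum_dist_monotone]), which the middle element of a 321
    pattern needs. Conversely, each path is given explicitly as a diagonal line clamped between
    start and target, hence has at most two corners; what remains is that no two paths share a
    position: [position_increasing] for movers of the same kind, [position_right_left] for the
    others. *)

(** * Adjacency as displacement by at most one position *)

Lemma far_apartE n (i j : 'I_n.-1) :
  far_apart i j = (i.+1 < j) || (j.+1 < i).
Proof. by rewrite /far_apart; lia. Qed.

Definition left_pos n (i : 'I_n.-1) : 'I_n := Ordinal (ltnW (ltn_pos_succ i)).
Definition right_pos n (i : 'I_n.-1) : 'I_n := Ordinal (ltn_pos_succ i).

Lemma right_posE n (i : 'I_n.-1) : right_pos i = (left_pos i).+1 :> nat.
Proof. by []. Qed.

Lemma swapE n (pi : 'S_n) i p :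
  swap pi i p = pi (tperm (left_pos i)
                          (right_pos i) p).
Proof. by rewrite /swap /sigma permM. Qed.

Lemma foldl_swapD n (pi : 'S_n) (ps : seq 'I_n.-1) (p : 'I_n) :
  (forall i, i \in ps -> (p != i :> nat) && (p != i.+1 :> nat)) ->
  foldl (@swap n) pi ps p = pi p.
Proof.
elim: ps pi => //= i ps IH pi ps_p.
rewrite IH => [|j ps_j]; last by apply: ps_p; rewrite inE ps_j orbT.
have /andP[p_i p_i1] := ps_p i (mem_head _ _).
by rewrite swapE tpermD // -val_eqE /= eq_sym.
Qed.

Lemma foldl_swap_mem n (pi : 'S_n) (ps : seq 'I_n.-1) (i : 'I_n.-1)
    (p q : 'I_n) :
    pairwise (@far_apart n) ps -> i \in ps -> p = i :> nat -> q = i.+1 :> nat ->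
  foldl (@swap n) pi ps p = pi q /\ foldl (@swap n) pi ps q = pi p.
Proof.
elim: ps pi => //= j ps IH pi /andP[/allP far_j far_ps].
rewrite inE => /predU1P[->|ps_i] pE qE.
  have far (r : 'I_n) : r = j :> nat \/ r = j.+1 :> nat ->
    foldl (@swap n) (swap pi j) ps r = swap pi j r.
    move=> rE; apply: foldl_swapD => k /far_j; rewrite far_apartE; lia.
  rewrite !far ?swapE; try by [left | right].
  have -> : left_pos j = p by apply: val_inj.
  have -> : right_pos j = q by apply: val_inj.
  by rewrite tpermL tpermR.
have [-> ->] := IH (swap pi j) far_ps ps_i pE qE.
have := far_j i ps_i; rewrite far_apartE => far_ji.
by rewrite !swapE !tpermD // -val_eqE /=; lia.
Qed.

Lemma obtained_from_close n (pi rho : 'S_n) x :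
  obtained_from pi rho -> `|((pi^-1%g x)%:Z - (rho^-1%g x)%:Z)%R| <= 1.
Proof.
case=> ps far_ps rhoE.
have [p ->] : exists p, x = rho p by exists (rho^-1%g x); rewrite permKV.
rewrite permK rhoE.
have [/hasP[i ps_i p_i] | /hasPn ps_p] :=
  boolP (has (fun i : 'I_n.-1 => (p == i :> nat) || (p == i.+1 :> nat)) ps).
  case/orP: p_i => /eqP pE.
    have [-> _] := foldl_swap_mem (q := right_pos i) pi far_ps ps_i pE erefl.
    by rewrite permK /=; lia.
  have [_ ->] := foldl_swap_mem (p := left_pos i) pi far_ps ps_i erefl pE.
  by rewrite permK /=; lia.
by rewrite foldl_swapD => [|i /ps_p]; [rewrite permK; lia | rewrite negb_or].
Qed.

(** The preimage of [p] is [q] or [p - 1]. In the second case induction at [p - 1] gives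
    [tau p = p - 1], against [tau p = q]. *)
Lemma close_perm_swap n (tau : 'S_n) (p q : 'I_n) :
  (forall r, `|((tau r)%:Z - r%:Z)%R| <= 1) ->
  q = p.+1 :> nat -> tau p = q -> tau q = p.
Proof.
move=> close; elim/ltn_ind: {p}(val p) {-2}p (erefl (val p)) q.
move=> k IH p pk q qE tau_p.
set r := tau^-1%g p; have tau_r : tau r = p by rewrite permKV.
have r_p : r != p :> nat.
  apply/negP => /eqP/val_inj rp.
  by move: tau_p; rewrite -{1}rp tau_r => /(congr1 val) /=; lia.
have := close r; rewrite tau_r => close_r.
have [rE | rE] : p = r.+1 :> nat \/ r = q :> nat by move: r_p; lia.
  have lt_rk : val r < k by rewrite /= in pk *; lia.
  have := IH _ lt_rk r erefl p rE tau_r.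
  by rewrite tau_p => qr; move: rE qE; rewrite qr; lia.
by rewrite -(val_inj rE) tau_r.
Qed.

(** For the converse, [rho] is [pi] precomposed with some [tau] of displacement at most one; by
    [close_perm_swap], [tau] is a product of disjoint adjacent transpositions, and [ps] lists their
    left positions. *)
Lemma adjacent_close n (pi rho : 'S_n) :
  adjacent pi rho <-> forall x, `|((pi^-1%g x)%:Z - (rho^-1%g x)%:Z)%R| <= 1.
Proof.
split=> [adj x | close].
  by case: adj => /(obtained_from_close x) //; lia.
left; pose tau : 'S_n := (rho * pi^-1)%g.
have rhoE p : rho p = pi (tau p) by rewrite permM permKV.
have tau_close r : `|((tau r)%:Z - r%:Z)%R| <= 1.
  by have := close (rho r); rewrite permK permM.
have tauV_close r : `|((tau^-1%g r)%:Z - r%:Z)%R| <= 1.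
  by have := tau_close (tau^-1%g r); rewrite permKV; lia.
pose ps := [seq i : 'I_n.-1 <- enum 'I_n.-1 |
  tau (left_pos i) == right_pos i].
have ps_far : pairwise (@far_apart n) ps.
  have: pairwise (fun i j : 'I_n.-1 => i < j) ps.
    apply: pairwise_filter; rewrite -(pairwise_map val ltn) val_enum_ord.
    by rewrite -sorted_pairwise ?iota_ltn_sorted //; apply: ltn_trans.
  apply: (sub_in_pairwise (P := [pred k | k \in ps])); last by apply/allP.
  move=> i j; rewrite !inE !mem_filter.
  move=> /andP[/eqP tau_i _] /andP[/eqP tau_j _] ltij.
  (* Otherwise [j = i + 1], and [tau] would send position [i + 1] both to [i] and to [i + 2]. *)
  rewrite far_apartE; apply: contraT; rewrite negb_or => far.
  have jE : j = i.+1 :> nat by lia.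
  have tau_i1 := close_perm_swap tau_close (right_posE i) tau_i.
  have eij : right_pos i = left_pos j by apply: val_inj.
  by move: tau_i1; rewrite eij tau_j => /(congr1 val) /=; lia.
exists ps => //; apply/permP => p; rewrite rhoE.
have mem_ps (i : 'I_n.-1) (r s : 'I_n) :
    r = i :> nat -> s = i.+1 :> nat -> tau r = s -> i \in ps.
  move=> rE sE tau_r; rewrite mem_filter mem_enum andbT.
  have -> : left_pos i = r by apply: val_inj.
  by have -> : right_pos i = s; [apply: val_inj | apply/eqP].
have := tau_close p; case: (ltngtP (tau p) p) => tau_p close_p.
- have pE : p = (tau p).+1 :> nat by lia.
  have tauVp : tau^-1%g (tau p) = p by rewrite permK.
  have tauV_p := close_perm_swap tauV_close pE tauVp.
  have lti : tau p < n.-1 by have := ltn_ord p; lia.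
  have tau_tau : tau (tau p) = p by rewrite -{1}tauV_p permKV.
  have ps_i := mem_ps (Ordinal lti) _ _ erefl pE tau_tau.
  by have [_ ->] := foldl_swap_mem pi ps_far ps_i erefl pE.
- have pE : tau p = p.+1 :> nat by lia.
  have lti : p < n.-1 by have := ltn_ord (tau p); lia.
  have ps_i := mem_ps (Ordinal lti) _ _ erefl pE erefl.
  by have [-> _] := foldl_swap_mem pi ps_far ps_i erefl pE.
rewrite foldl_swapD ?(val_inj tau_p) // => i.
rewrite mem_filter => /andP[/eqP tau_i _].
have tau_i1 := close_perm_swap tau_close (right_posE i) tau_i.
apply/andP; split; apply/eqP => pE.
  have pE' : p = left_pos i by apply: val_inj.
  by move: tau_p; rewrite pE' tau_i /=; lia.
have pE' : p = right_pos i by apply: val_inj.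
by move: tau_p; rewrite pE' tau_i1 /=; lia.
Qed.

(** * Corners as total variation of the velocity *)

Definition velocity n (T : seq 'S_n) x t : int := (path_piece T x t).1.

Lemma velocityE n (T : seq 'S_n) x t :
  velocity T x t =
  (((perm_at T t.+1)^-1%g x)%:Z - ((perm_at T t)^-1%g x)%:Z)%R.
Proof. by rewrite /velocity /path_piece /path_point /=; lia. Qed.

Lemma corner_multE (u v : int * int) :
  `|u.1| <= 1 -> `|v.1| <= 1 -> u.2 = v.2 ->
  corner_mult u v = `|(v.1 - u.1)%R|%N.
Proof.
case: u v => [u d] [v e] /= u1 v1 <-.
rewrite /corner_mult xpair_eqE eqxx andbT /=.
by case: (u =P v) => [->|]; [rewrite subrr | case: eqP; case: eqP => /=; lia].
Qed.

Lemma corners_velocity n (T : seq 'S_n) x :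
  (forall t, t < (size T).-1 -> `|velocity T x t| <= 1) ->
  corners T x =
  \sum_(1 <= t < (size T).-1) `|(velocity T x t - velocity T x t.-1)%R|%N.
Proof.
move=> v1; apply: eq_big_nat => t /andP[t0 tm].
apply: corner_multE; try by apply: v1; lia.
by rewrite /path_piece /path_point /=; lia.
Qed.

Lemma dist_leq_sum (v : nat -> int) a b : a <= b ->
  `|(v b - v a)%R|%N <= \sum_(a.+1 <= t < b.+1) `|(v t - v t.-1)%R|%N.
Proof.
move/subnKC <-; elim: (b - a) => [|k IH]; first by rewrite addn0 subrr.
by rewrite addnS big_nat_recr /=; lia.
Qed.

(** Passing from 0 through 1 and -1, in either order, back to 0 costs at least 1 + 2 + 1 = 4. *)
Lemma sum_dist_monotone (v : nat -> int) m s u :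
  s < m -> u < m -> v 0 = 0%R -> v m.-1 = 0%R ->
  \sum_(1 <= t < m) `|(v t - v t.-1)%R|%N <= 2 ->
  v s = 1%R -> v u = (-1)%R -> False.
Proof.
move=> sm um v0 vm TV vs vu.
have split3 a b : a <= b -> b < m ->
    `|(v a - v 0)%R|%N + `|(v b - v a)%R|%N + `|(v m.-1 - v b)%R|%N <=
    \sum_(1 <= t < m) `|(v t - v t.-1)%R|%N.
  move=> ab bm; rewrite (@big_cat_nat _ _ _ b.+1) //.
  rewrite (@big_cat_nat _ _ _ a.+1 1) //=.
  have dist_m : `|(v m.-1 - v b)%R|%N <=
      \sum_(b.+1 <= t < m) `|(v t - v t.-1)%R|%N.
    by have := @dist_leq_sum v b m.-1; rewrite prednK; lia.
  by rewrite !leq_add ?dist_leq_sum.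
have [su | /ltnW us] := leqP s u.
  by have := split3 s u su um; lia.
by have := split3 u s us sm; lia.
Qed.

(** * Necessity of 321-avoidance *)

Lemma direct_321_avoiding n (T : seq 'S_n) pi :
  direct_tangle T pi -> avoids pi perm321.
Proof.
case=> -[T1 adjT start stop] [T0 Tm] cornersT [i i_mono pi_i].
set m := (size T).-1 in adjT stop Tm cornersT.
pose pos t x : 'I_n := (perm_at T t)^-1%g x.
have v_le1 x t : t < m -> `|velocity T x t| <= 1.
  by move=> /adjT /adjacent_close /(_ x); rewrite velocityE; lia.
have one_way x s u : s < m -> u < m ->
    velocity T x s = 1%R -> velocity T x u = (-1)%R -> False.
  move=> sm um; apply: (sum_dist_monotone (m := m) (v := velocity T x)) => //.
  - by rewrite velocityE -start subrr.
  - by rewrite velocityE stop prednK ?subrr //; lia.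
  - by rewrite -corners_velocity // => t; apply: v_le1.
have crossing x y : pos 0 x < pos 0 y -> y < x ->
    exists2 t, t < m & velocity T x t = 1%R /\ velocity T y t = (-1)%R.
  move=> pos_xy ltyx.
  (* At the first time [t] when [y] is left of [x], the order has just been reversed by moves of at
     most one, so [x] moved right and [y] left during step [t - 1]. *)
  have ex_t : exists t, pos t y < pos t x by exists m; rewrite /pos Tm invg1 !perm1.
  case: (ex_minnP ex_t) => t pos_t min_t.
  have t0 : 0 < t by case: t pos_t {min_t} => // ; lia.
  have tm : t <= m by apply: min_t; rewrite /pos Tm invg1 !perm1.
  have pos_t1 : pos t.-1 x <= pos t.-1 y.
    by rewrite leqNgt; apply/negP => /min_t; lia.
  have tm1 : t.-1 < m by lia.
  have ne : pos t.-1 x != pos t.-1 y :> nat.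
    by apply/eqP => /val_inj/perm_inj xy; move: ltyx; rewrite xy ltnn.
  exists t.-1 => //; move: (v_le1 x _ tm1) (v_le1 y _ tm1) pos_t pos_t1 ne.
  by rewrite !velocityE prednK // /pos; lia.
pose a : 'I_3 := ord0; pose c : 'I_3 := ord_max.
pose b : 'I_3 := Ordinal (isT : 1 < 3).
have pos0 r : pos 0 (pi (i r)) = i r by rewrite /pos T0 permK.
have inv (r s : 'I_3) : r < s -> pi (i s) < pi (i r).
  move=> rs; have := pi_i r s rs; rewrite !permE /= => pi_rs.
  have : pi (i r) != pi (i s) :> nat.
    by rewrite (inj_eq val_inj) (inj_eq perm_inj) -(inj_eq val_inj) neq_ltn i_mono.
  lia.
have [|s sm [_ vb_left]] := crossing (pi (i a)) (pi (i b)) _ (inv a b isT).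
  by rewrite !pos0 i_mono.
have [|u um [vb_right _]] := crossing (pi (i b)) (pi (i c)) _ (inv b c isT).
  by rewrite !pos0 i_mono.
exact: (one_way (pi (i b)) u s).
Qed.

(** * Tools for the converse: one-interval velocities, and ranks *)

Lemma sum_nat_pred1_le1 a m : \sum_(1 <= t < m) (t == a) <= 1.
Proof.
rewrite -big_mkcond /= sum1_count.
by rewrite (@eq_count _ _ (pred1 a)) ?count_uniq_mem ?iota_uniq ?leq_b1.
Qed.

(** The velocity can change only at [a] and at [b], by at most 1 each time. *)
Lemma sum_dist_indicator (d : int) a b (v : nat -> int) m :
  `|d| <= 1 -> (forall t, v t = if a <= t < b then d else 0%R) ->
  \sum_(1 <= t < m) `|(v t - v t.-1)%R|%N <= 2.
Proof.
move=> d1 vE.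
have step t : 0 < t -> `|(v t - v t.-1)%R|%N <= (t == a) + (t == b).
  move=> t0; rewrite !vE; case: (t =P a); case: (t =P b); case: ifP; case: ifP; lia.
apply: (@leq_trans (\sum_(1 <= t < m) ((t == a) + (t == b)))).
  rewrite big_nat [X in _ <= X]big_nat.
  by apply: leq_sum => t /andP[t0 _]; apply: step.
by rewrite big_split /= (@leq_add _ _ 1 1) ?sum_nat_pred1_le1.
Qed.

Lemma no_321 n (pi : 'S_n) (p q r : 'I_n) :
  avoids pi perm321 -> p < q -> q < r -> pi r < pi q -> pi q < pi p -> False.
Proof.
move=> av pq qr rq_pi qp_pi; apply: av.
exists (fun k : 'I_3 => nth p [:: p; q; r] k).
  by case=> [[|[|[|]]]] ? // [[|[|[|]]]] ? //= _; lia.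
by case=> [[|[|[|]]]] ? // [[|[|[|]]]] ? //= _; rewrite !permE /=; lia.
Qed.

(** Used with [s] sending elements to their starting positions, or with [s = 1] for their targets;
    at an element of [S] it is its index within [S], from 0. *)
Definition rank n (S : {set 'I_n}) (s : 'S_n) (v : nat) : nat :=
  #|[set x in S | s x < v]|.

Lemma leq_rank n (S : {set 'I_n}) (s : 'S_n) u v :
  u <= v -> rank S s u <= rank S s v.
Proof.
move=> uv; apply/subset_leq_card/subsetP => x; rewrite !inE => /andP[-> /=].
by move/leq_trans; apply.
Qed.

Lemma ltn_rank n (S : {set 'I_n}) (s : 'S_n) x v :
  x \in S -> s x < v -> rank S s (s x) < rank S s v.
Proof.
move=> Sx xv; apply: proper_card; apply/properP; split.
  apply/subsetP => y; rewrite !inE => /andP[-> /=].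
  by move/ltn_trans; apply.
by exists x; rewrite !inE Sx ?xv // ltnn.
Qed.

Lemma card_perm_lt n (s : 'S_n) v : v <= n -> #|[set x | s x < v]| = v.
Proof.
move=> vn; have -> : [set x | s x < v] = s @^-1: [set y : 'I_n | y < v].
  by apply/setP => x; rewrite !inE.
rewrite card_preimset; last exact: perm_inj.
rewrite -sum1dep_card -(big_ord_widen_cond n predT (fun=> 1) vn) /=.
by rewrite sum1_card card_ord.
Qed.

Lemma rank_setC n (S : {set 'I_n}) (s : 'S_n) v :
  v <= n -> rank S s v + rank (~: S) s v = v.
Proof.
move=> vn; rewrite -[RHS](card_perm_lt s vn) -(cardsID S [set x | s x < v]).
by congr (_ + _); apply: eq_card => x; rewrite !inE andbC.
Qed.

(** * Construction of a direct tangle *)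

Section Construction.

Variables (n : nat) (pi : 'S_n).
Hypothesis pi_av : avoids pi perm321.

Let start : 'S_n := (pi^-1)%g.
Let R : {set 'I_n} := [set x | start x < x].
Let L : {set 'I_n} := ~: R.

Let startK x : pi (start x) = x. Proof. exact: permKV. Qed.

Let no_321_start x y z :
  start x < start y -> start y < start z -> z < y -> y < x -> False.
Proof. by move=> xy yz zy yx; apply: (no_321 pi_av xy yz); rewrite !startK. Qed.

(** If [y] started left of [x], then since [start x < x], by counting some [c < x] starts right of
    [x], and [y], [x], [c] form a 321 pattern. *)
Lemma right_increasing x y : x \in R -> y \in R -> x < y -> start x < start y.
Proof.
rewrite !inE => Rx Ry xy; rewrite ltnNge; apply/negP => le_yx.
have lt_yx : start y < start x.
  rewrite ltn_neqAle le_yx andbT (inj_eq val_inj) (inj_eq perm_inj).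
  by rewrite -(inj_eq val_inj) neq_ltn xy orbT.
have [c cx xc] : exists2 c : 'I_n, c < x & start x < start c.
  apply/exists_inP; apply: contraT; rewrite negb_exists_in => /forall_inP noc.
  have: #|[set c : 'I_n | (1%g : 'S_n) c < x]| <= #|[set c | start c < start x]|.
    apply/subset_leq_card/subsetP => c; rewrite !inE perm1 => cx.
    have := noc c cx; rewrite -leqNgt leq_eqVlt => /orP[|//].
    move=> /eqP/val_inj/perm_inj cx'.
    by move: cx; rewrite cx' ltnn.
  by rewrite !card_perm_lt; [lia | apply: ltnW..].
exact: (no_321_start lt_yx xc cx xy).
Qed.

Lemma left_increasing x y : x \in L -> y \in L -> x < y -> start x < start y.
Proof.
rewrite !inE -!leqNgt => Lx Ly xy; rewrite ltnNge; apply/negP => le_yx.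
have lt_yx : start y < start x.
  rewrite ltn_neqAle le_yx andbT (inj_eq val_inj) (inj_eq perm_inj).
  by rewrite -(inj_eq val_inj) neq_ltn xy orbT.
have [c yc cy] : exists2 c : 'I_n, y < c & start c < start y.
  apply/exists_inP; apply: contraT; rewrite negb_exists_in => /forall_inP noc.
  have: #|[set c | start c < start y]| < #|[set c : 'I_n | (1%g : 'S_n) c < y]|.
    apply: proper_card; apply/properP; split.
      apply/subsetP => c; rewrite !inE perm1 => cy; rewrite ltnNge leq_eqVlt.
      apply/negP => /orP[/eqP/val_inj yc | /noc]; last by rewrite cy.
      by move: cy; rewrite yc ltnn.
    (* The element [x] makes the inclusion strict, as needed because a left mover only satisfies
       [y <= start y]. *)
    by exists x; rewrite !inE ?perm1 // -leqNgt.
  by rewrite !card_perm_lt; [lia | apply: ltnW..].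
exact: (no_321_start cy lt_yx xy yc).
Qed.

Lemma rank_start (S : {set 'I_n}) x :
  (forall x y, x \in S -> y \in S -> x < y -> start x < start y) ->
  x \in S -> rank S start (start x) = rank S 1 x.
Proof.
move=> incr Sx; apply: eq_card => y; rewrite !inE perm1.
case Sy: (y \in S) => //=; case: (ltngtP y x) => [|xy|/val_inj ->].
- exact: incr.
- by apply/negbTE; rewrite -leqNgt ltnW ?incr.
- by rewrite ltnn.
Qed.

(* The path of the i-th right mover has to be at i + j at time j - i for each  *)
(* of its crossings, so it follows the line p = t + 2 i, clamped between its   *)
(* start and its target; dually, the j-th left mover follows p = 2 j + 1 - t.  *)
(* Times are shifted to be natural, and so that all paths start and end        *)
(* vertical.                                                                   *)
Definition shift := (2 * n).+1.

Definition position s x : nat :=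
  if x \in R then maxn (start x) (minn x (s + 2 * rank R 1 x - shift))
  else maxn x (minn (start x) ((2 * rank L 1 x + shift).+1 - s)).

Lemma rank_le (S : {set 'I_n}) (s : 'S_n) (x : 'I_n) : rank S s x <= n.
Proof. by rewrite -[leqRHS]card_ord max_card. Qed.

Lemma position_lt s x : position s x < n.
Proof.
by rewrite /position; have := ltn_ord x; have := ltn_ord (start x); case: ifP; lia.
Qed.

Lemma position_start s x : s <= 1 -> position s x = start x.
Proof.
rewrite /position /shift => s1; have := rank_le R 1 x; have := ltn_ord (start x).
by case: ifPn; rewrite inE; lia.
Qed.

Lemma position_end s x : 4 * n + 3 <= s -> position s x = x.
Proof.
rewrite /position /shift => s1; have := rank_le L 1 x; have := ltn_ord x.
by case: ifPn; rewrite inE; lia.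
Qed.

Lemma position_close s x :
  `|((position s.+1 x)%:Z - (position s x)%:Z)%R| <= 1.
Proof. by rewrite /position; case: ifP; lia. Qed.

(** Starts, targets and, through the ranks, the lines are ordered alike, and clamping keeps this
    order. Where a truncated subtraction gives 0, the lower clamp decides. *)
Lemma position_increasing s x y :
  (x \in R) = (y \in R) -> x < y -> position s x < position s y.
Proof.
rewrite /position => Rxy xy.
case: (boolP (x \in R)) => Rx; have Ry := Rx; rewrite Rxy in Ry;
  rewrite ?Ry ?(negbTE Ry).
  have := right_increasing Rx Ry xy.
  by have := @ltn_rank _ R 1%g x y Rx; rewrite perm1; lia.
rewrite -!in_setC in Rx Ry.
have := left_increasing Rx Ry xy.
by have := @ltn_rank _ L 1%g x y Rx; rewrite perm1; lia.
Qed.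

(** Let [x] and [y] have ranks [i] and [j]. By [rank_setC], the start and the target of each lie at
    most at [i + j] or at least at [i + j + 1], according to its order with the other. If the paths
    do not cross, they stay on opposite sides of this gap; if they do, both lines jump the gap in
    the same step, from time [j - i] to [j - i + 1]. *)
Lemma position_right_left s x y :
  x \in R -> y \in L -> position s x <> position s y.
Proof.
move=> Rx Ly; have RyF : y \in R = false by apply/negbTE; rewrite -in_setC.
have rank1 z : z <= n -> rank R 1 z + rank L 1 z = z := @rank_setC _ R 1%g z.
have rank_st z : z <= n -> rank R start z + rank L start z = z :=
  @rank_setC _ R start z.
have xn := ltn_ord x; have yn := ltn_ord y.
have sxn := ltn_ord (start x); have syn := ltn_ord (start y).
have x1 := rank1 x (ltnW xn); have y1 := rank1 y (ltnW yn).
have xs := rank_st _ (ltnW sxn); have ys := rank_st _ (ltnW syn).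
have eqx := rank_start right_increasing Rx.
have eqy := rank_start left_increasing Ly.
have lt_start : start y < start x \/ start x < start y.
  case: (ltngtP (start x) (start y)) => [||/val_inj/perm_inj xy];
    [by right | by left |].
  by move: Rx; rewrite xy RyF.
have lt_end : y < x \/ x < y.
  case: (ltngtP x y) => [||/val_inj xy]; [by right | by left |].
  by move: Rx; rewrite xy RyF.
have start_facts :
  [/\ start y < start x, rank L 1 y < rank L start (start x)
    & rank R start (start y) <= rank R 1 x] \/
  [/\ start x < start y, rank L start (start x) <= rank L 1 y
    & rank R 1 x < rank R start (start y)].
  rewrite -eqx -eqy.
  by case: lt_start => lt; [left | right]; rewrite ltn_rank ?leq_rank ?(ltnW lt).
have end_facts :
  [/\ y < x, rank L 1 y < rank L 1 x & rank R 1 y <= rank R 1 x] \/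
  [/\ x < y, rank L 1 x <= rank L 1 y & rank R 1 x < rank R 1 y].
  have := @ltn_rank _ R 1%g x y Rx; have := @ltn_rank _ L 1%g y x Ly.
  rewrite !perm1 => ltL ltR.
  by case: lt_end => lt; [left | right]; rewrite ?ltL ?ltR ?leq_rank ?(ltnW lt).
move: (Rx) (Ly); rewrite /position Rx RyF !inE -leqNgt => lex ley.
clear lt_start lt_end rank1 rank_st.
(* Of the four cases, [y] starting left of [x] and ending right of it is contradictory: it would
   force [x < start x]. *)
by case: start_facts => -[? ? ?]; case: end_facts => -[? ? ?]; lia.
Qed.

Lemma position_inj s : injective (fun x => Ordinal (position_lt s x)).
Proof.
move=> x y /(congr1 val) /= pos_xy.
have [Rxy | Rxy] := eqVneq (x \in R) (y \in R).
  case: (ltngtP x y) => [lt|lt|/val_inj //].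
    by have := position_increasing s Rxy lt; rewrite pos_xy ltnn.
  by have := position_increasing s (esym Rxy) lt; rewrite pos_xy ltnn.
move: Rxy; case: (boolP (x \in R)) => Rx; case: (boolP (y \in R)) => Ry // _.
  by case: (@position_right_left s x y); rewrite // in_setC.
by case: (@position_right_left s y x); rewrite // in_setC.
Qed.

(** [position] sends elements to positions, hence the inverse. The times are 0 to [4 * n + 4]; by
    [position_start] and [position_end], the first and last steps are stationary. *)
Definition tangle : seq 'S_n :=
  mkseq (fun s => (perm (@position_inj s))^-1%g) (4 * n + 5).

Lemma perm_at_tangle s x :
  s <= 4 * n + 4 -> (perm_at tangle s)^-1%g x = position s x :> nat.
Proof. by move=> sm; rewrite /perm_at nth_mkseq ?invgK ?permE //; lia. Qed.

Lemma eq_perm_at (s : nat) (rho : 'S_n) :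
  s <= 4 * n + 4 -> (forall x, position s x = rho^-1%g x) -> perm_at tangle s = rho.
Proof.
move=> sm pos_rho; apply: invg_inj; apply/permP => x; apply: val_inj.
by rewrite /= perm_at_tangle.
Qed.

Lemma position_indicator x :
  exists (d : int) a b, `|d| <= 1 /\
  forall s, ((position s.+1 x)%:Z - (position s x)%:Z)%R =
            if a <= s < b then d else 0%R.
Proof.
rewrite /position; have := rank_le R 1 x; have := rank_le L 1 x.
have := ltn_ord x; have := ltn_ord (start x); rewrite /shift.
case: (x \in R) => xn sn Ln Rn.
  (* The interval runs from the time when the line passes the start to the time when it passes the
     target; ranks are at most [n], so nothing is truncated. *)
  exists 1%R, (start x + (2 * n).+1 - 2 * rank R 1 x).
  exists (x + (2 * n).+1 - 2 * rank R 1 x).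
  by split=> // s; case: ifP; lia.
exists (-1)%R, ((2 * rank L 1 x + (2 * n).+1).+1 - start x).
exists ((2 * rank L 1 x + (2 * n).+1).+1 - x).
by split=> // s; case: ifP; lia.
Qed.

Lemma direct_tangle_tangle : direct_tangle tangle pi.
Proof.
have size_T : (size tangle).-1 = 4 * n + 4 by rewrite size_mkseq; lia.
have start_eq s : s <= 1 -> perm_at tangle s = pi.
  by move=> s1; apply: eq_perm_at => [|x]; [lia | rewrite position_start].
have end_eq s : 4 * n + 3 <= s <= 4 * n + 4 -> perm_at tangle s = 1%g.
  by move=> sm; apply: eq_perm_at => [|x]; rewrite ?position_end ?invg1 ?perm1; lia.
split.
- rewrite /is_tangle size_T; split.
  + by rewrite size_mkseq; lia.
  + move=> t tm; apply/adjacent_close => x.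
    by rewrite !perm_at_tangle; try lia; have := position_close t x; lia.
  + by rewrite !start_eq.
  + by rewrite !end_eq //; lia.
- by rewrite /solves size_T start_eq ?end_eq //; lia.
move=> x; have velocity_pos t : t < 4 * n + 4 ->
    velocity tangle x t = ((position t.+1 x)%:Z - (position t x)%:Z)%R.
  by move=> tm; rewrite velocityE !perm_at_tangle //; lia.
rewrite corners_velocity size_T => [|t tm]; last first.
  by rewrite velocity_pos // position_close.
have [d [a [b [d1 vE]]]] := position_indicator x.
apply: leq_trans (sum_dist_indicator (4 * n + 4) d1 vE); apply: eq_leq.
apply: eq_big_nat => t /andP[t0 tm].
by rewrite !velocity_pos //; lia.
Qed.

End Construction.

Theorem theorem1 (n : nat) (pi : 'S_n) :
  (exists T : seq 'S_n, direct_tangle T pi) <-> avoids pi perm321.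
Proof.
split=> [[T direct_T] | av]; first exact: direct_321_avoiding direct_T.
by exists (tangle av); apply: direct_tangle_tangle.
Qed.
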